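(* Let $(X,\mathcal B,\mu)$ be a probability space and let $\mathfrak U=\{U_k:\ k=1,2,\ldots,n\}$ be a set of invertible commuting measure-preserving transformations of $X$ of rank $d\ge1$, and suppose that an independent subset of cardinality $d$ in $\mathfrak U$ is non-periodic. Let $\Phi:\mathbb R^+\to\mathbb R^+$ be a non-decreasing function with $\Phi(t)=o(t\log^{d-1}t)$ as $t\to\infty$. Then there exists a function $f\in L_\Phi(X)$ such that the averages $$\frac{1}{s_1\cdots s_n}\sum_{j_1=0}^{s_1-1}\cdots\sum_{j_n=0}^{s_n-1}f\left(U_1^{j_1}\cdots U_n^{j_n}x\right)$$ diverge for almost every $x\in X$ as $\min_j s_j\to\infty$.
   Context: A measurable map $T:X\to X$ on a probability space $(X,\mathcal B,\mu)$ is measure-preserving if $T^{-1}(E)\in\mathcal B$ and $\mu(T^{-1}(E))=\mu(E)$ for every $E\in\mathcal B$. A set of invertible commuting measure-preserving transformations $\{V_k:\ k=1,\ldots,m\}$ is dependent if there are integers $p_1,\ldots,p_m$, not all zero, such that $(V_1^{p_1}\circ\cdots\circ V_m^{p_m})(x)=x$ for almost every $x\in X$; otherwise it is independent. It is non-periodic if for every choice of integers $p_1,\ldots,p_m$, not all zero, $\mu\{x:\ (V_1^{p_1}\circ\cdots\circ V_m^{p_m})(x)=x\}=0$. The rank of $\mathfrak U$ is the largest integer $r$ for which there is an independent subset of cardinality $r$ in $\mathfrak U$. $L_\Phi(X)$ is the class of $\mathcal B$-measurable functions $f$ on $X$ with $\Phi(|f|)\in L^1(X)$. Here $\log^{d-1}t=(\log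 t)^{d-1}$. The $s_j$ are positive integers.
   Formalization: The probability space is also assumed to have countably many measurable sets separating points off a null set (true in every Lebesgue space); the claim fails without it, e.g. for x→x+1 on the reals with the countable/cocountable σ-algebra and 0/1 measure. *)

(* Defs.v *)
From HB Require Import structures.
From mathcomp Require Import all_boot all_order all_algebra.
From mathcomp Require Import all_classical all_reals all_analysis.

Set Implicit Arguments.
Unset Strict Implicit.
Unset Printing Implicit Defensive.

Import Order.TTheory GRing.Theory Num.Theory.
Import numFieldNormedType.Exports.

Local Open Scope classical_set_scope.
Local Open Scope ring_scope.

(* Invertible measure-preserving transformations: the inverse is measurable
   too, and it then automatically preserves the measure. *)
Record mp_aut (d : measure_display) (T : measurableType d) (R : realType)
    (mu : probability T R) := MpAut {
  aut_fun :> T -> T;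
  aut_inv : T -> T;
  aut_funK : cancel aut_fun aut_inv;
  aut_invK : cancel aut_inv aut_fun;
  aut_fun_measurable : measurable_fun setT aut_fun;
  aut_inv_measurable : measurable_fun setT aut_inv;
  aut_preserving :
    forall E : set T, measurable E -> mu (aut_fun @^-1` E) = mu E }.

Definition aut_pow (d : measure_display) (T : measurableType d) (R : realType)
    (mu : probability T R) (V : mp_aut mu) (p : int) : T -> T :=
  match p with
  | Posz k => iter k V
  | Negz k => iter k.+1 (aut_inv V)
  end.

(* The composition of the [V_i ^ p_i], [i] ranging over [I] in increasing
   order.  The subsets of a family [V_0, ..., V_(n-1)] are given by sets of
   indices.  If [V_i = V_j] with [i != j], an index set containing both is
   dependent (take [p_i = 1], [p_j = -1]), so that the independent index sets
   have the same cardinality as the set of transformations they represent. *)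
Definition monomial (d : measure_display) (T : measurableType d)
    (R : realType) (mu : probability T R) (n : nat) (V : 'I_n -> mp_aut mu)
    (I : {set 'I_n}) (p : 'I_n -> int) : T -> T :=
  \big[(fun f g : T -> T => f \o g)/id]_(i in I) aut_pow (V i) (p i).

Definition dependent (d : measure_display) (T : measurableType d)
    (R : realType) (mu : probability T R) (n : nat) (V : 'I_n -> mp_aut mu)
    (I : {set 'I_n}) : Prop :=
  exists p : 'I_n -> int,
    (exists2 i, i \in I & p i != 0) /\
    {ae mu, forall x, monomial V I p x = x}.

Definition independent (d : measure_display) (T : measurableType d)
    (R : realType) (mu : probability T R) (n : nat) (V : 'I_n -> mp_aut mu)
    (I : {set 'I_n}) : Prop :=
  ~ dependent V I.

(* "Measure zero" is expressed by [negligible] (contained in a measurable set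
   of measure zero), because [mu] need not be complete. *)
Definition nonperiodic (d : measure_display) (T : measurableType d)
    (R : realType) (mu : probability T R) (n : nat) (V : 'I_n -> mp_aut mu)
    (I : {set 'I_n}) : Prop :=
  forall p : 'I_n -> int, (exists2 i, i \in I & p i != 0) ->
    mu.-negligible [set x | monomial V I p x = x].

Definition aut_rank (d : measure_display) (T : measurableType d)
    (R : realType) (mu : probability T R) (n : nat)
    (V : 'I_n -> mp_aut mu) : nat :=
  \max_(I : {set 'I_n} | `[< independent V I >]) #|I|.

(* Countably many measurable sets separate the points, up to a null set.  This
   holds in every Lebesgue space (in the sense of Rokhlin) and in every
   standard Borel probability space.  Without such a property, "V x <> x" for
   almost every x says nothing about the action of V on measurable sets. *)
Definition countably_separated (d : measure_display) (T : measurableType d)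
    (R : realType) (mu : probability T R) : Prop :=
  exists (A : nat -> set T) (N : set T),
    [/\ forall k, measurable (A k), mu.-negligible N &
        forall x y, ~ N x -> ~ N y -> (forall k, A k x <-> A k y) -> x = y].

(* [f] belongs to L_Phi; [mu.-integrable] alone would not force [f] itself to
   be measurable. *)
Definition in_LPhi (d : measure_display) (T : measurableType d)
    (R : realType) (mu : probability T R) (Phi : R -> R) (f : T -> R) : Prop :=
  measurable_fun setT f /\
  mu.-integrable setT (fun x => (Phi `|f x|)%:E).

Definition ergodic_avg (d : measure_display) (T : measurableType d)
    (R : realType) (mu : probability T R) (n : nat) (U : 'I_n -> mp_aut mu)
    (f : T -> R) (s : 'I_n -> nat) (x : T) : R :=
  (\prod_(i < n) (s i)%:R)^-1 *
  \sum_(j : {dffun forall i : 'I_n, 'I_(s i)})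
    f (monomial U [set: 'I_n] (fun i => Posz (j i)) x).

(* The filter "min_j s_j --> oo" on multi-indices; the [s_j] are eventually
   positive along it. *)
Definition min_to_oo (n : nat) : set_system ('I_n -> nat) :=
  filter_from setT (fun N : nat => [set s | forall i, (N <= s i)%N]).

Instance min_to_oo_filter (n : nat) : ProperFilter (@min_to_oo n).
Proof.
apply: filter_from_proper; last by move=> N _; exists (fun=> N) => i /=.
apply: filter_from_filter; first by exists 0%N.
move=> M N _ _; exists (maxn M N) => // s /= h; split=> i;
  by apply: leq_trans (h i); rewrite ?leq_maxl ?leq_maxr.
Qed.

(* Lets the Landau notation [f =o_ (pinfty_nbhs R) g] be used at +oo. *)
Canonical pinfty_filter_on (R : realType) := FilterType (pinfty_nbhs R) _.

(* Main.v *)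
(** For f >= 0 an average is at least its last term divided by the volume of the
box, so it suffices to make single values of f large.  At stage N let f equal M
on a set E, and consider only the boxes of volume at most M / N whose sides are
at least N, equal to N outside the independent index set I (so that the other
transformations cost only a factor depending on N).  The corners of these
boxes form a set S of exponents with |S| of order M (log M)^(d-1), which is much
larger than Phi(M).  Since the action along I is free, a greedy choice gives E of
measure at most 1 / (theta |S|) such that all x up to measure theta are sent into
E by some element of S; for these x an average is at least N, while the cost
Phi(M) mu(E) is as small as desired.  The function f is the maximum of the
peaks M_k 1_(E_k) over all the stages. *)

Require Import Defs.
From mathcomp Require Import all_boot all_order all_algebra.
From mathcomp Require Import all_classical all_reals all_analysis.
From mathcomp Require Import measurable_realfun ring lra zify.

Set Implicit Arguments.
Unset Strict Implicit.
Unset Printing Implicit Defensive.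

Import Order.TTheory GRing.Theory Num.Theory.
Import numFieldNormedType.Exports.
Local Open Scope classical_set_scope.
Local Open Scope ring_scope.

(** * The group generated by commuting automorphisms, and freeness along [I] *)

Section group_action.
Context (d : measure_display) (T : measurableType d) (R : realType)
  (mu : probability T R).
Implicit Types (V W : mp_aut mu) (N : set T).

Definition mp_id : mp_aut mu :=
  @MpAut d T R mu id id (fun=> erefl) (fun=> erefl)
    (@measurable_id _ _ _) (@measurable_id _ _ _) (fun _ _ => erefl).

Lemma aut_inv_preserving V E :
  measurable E -> mu (aut_inv V @^-1` E) = mu E.
Proof.
move=> mE; rewrite -(aut_preserving V); last first.
  by rewrite -[X in measurable X]setTI; exact: aut_inv_measurable.
by congr (mu _); apply/seteqP; split => x /=; rewrite aut_funK.
Qed.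

Definition mp_inv V : mp_aut mu :=
  MpAut (aut_invK V) (aut_funK V) (aut_inv_measurable V)
    (aut_fun_measurable V) (aut_inv_preserving V).

Lemma mp_comp_preserving V W E :
  measurable E -> mu ((V \o W) @^-1` E) = mu E.
Proof.
move=> mE; rewrite comp_preimage !aut_preserving//.
by rewrite -[X in measurable X]setTI; exact: aut_fun_measurable.
Qed.

Definition mp_comp V W : mp_aut mu :=
  MpAut (can_comp (aut_funK V) (aut_funK W))
    (can_comp (aut_invK W) (aut_invK V))
    (measurableT_comp (aut_fun_measurable V) (aut_fun_measurable W))
    (measurableT_comp (aut_inv_measurable W) (aut_inv_measurable V))
    (mp_comp_preserving V W).

Lemma mp_preimage_measurable V E : measurable E -> measurable (V @^-1` E).
Proof.
by move=> mE; rewrite -[X in measurable X]setTI; exact: aut_fun_measurable.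
Qed.

Lemma mp_preimage_negligible V N :
  mu.-negligible N -> mu.-negligible (V @^-1` N).
Proof.
move=> [M [mM M0 NM]]; exists (V @^-1` M); split.
- exact: mp_preimage_measurable.
- by rewrite aut_preserving.
- by move=> x; exact: NM.
Qed.

Lemma aut_pow_mp V p : exists W : mp_aut mu, aut_fun W = aut_pow V p.
Proof.
have H W k : exists W' : mp_aut mu, aut_fun W' = iter k W.
  elim: k => [|k [W' IH]]; first by exists mp_id.
  by exists (mp_comp W W') => /=; rewrite IH.
by case: p => k; [exact: H|exact: (H (mp_inv V))].
Qed.

(** Lets a monomial be handled as an automorphism, so that its preimages keep measurability, measure
    and negligibility. *)
Lemma monomial_mp n (V : 'I_n -> mp_aut mu) (I : {set 'I_n}) p :
  exists W : mp_aut mu, aut_fun W = monomial V I p.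
Proof.
rewrite /monomial; elim/big_ind: _ => [|f g [V1 <-] [V2 <-]|i _].
- by exists mp_id.
- by exists (mp_comp V1 V2).
- exact: aut_pow_mp.
Qed.

Lemma aut_powS V p x : aut_pow V (p + 1) x = V (aut_pow V p x).
Proof.
case: p => k; first by rewrite -PoszD addn1.
case: k => [|k]; first by rewrite /= aut_invK.
have -> : Negz k.+1 + 1 = Negz k by rewrite !NegzE; lia.
by rewrite [in RHS]/= aut_invK.
Qed.

Lemma aut_powB1 V p x : aut_pow V (p - 1) x = aut_inv V (aut_pow V p x).
Proof. by rewrite -{2}(subrK 1 p) aut_powS aut_funK. Qed.

Lemma aut_powD V p q x : aut_pow V (p + q) x = aut_pow V p (aut_pow V q x).
Proof.
elim/int_rec: p => [|k IH|k IH]; first by rewrite add0r.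
- by rewrite -addn1 PoszD addrAC !aut_powS IH.
- by rewrite -addn1 PoszD opprD addrAC !aut_powB1 IH.
Qed.

Lemma aut_pow_comm V (f : T -> T) p :
  (forall x, f (V x) = V (f x)) ->
  forall x, f (aut_pow V p x) = aut_pow V p (f x).
Proof.
move=> fV x; elim/int_rec: p => // k IH.
- by rewrite -addn1 PoszD !aut_powS fV IH.
- rewrite -addn1 PoszD opprD !aut_powB1 -IH.
  by apply: (can_inj (aut_funK V)); rewrite -fV !aut_invK.
Qed.

Lemma big_comp_split (I : Type) (r : seq I) (P : pred I) (F G : I -> T -> T) :
  (forall i j x, F i (G j x) = G j (F i x)) ->
  \big[(fun f g : T -> T => f \o g)/id]_(i <- r | P i) (F i \o G i) =
  \big[(fun f g : T -> T => f \o g)/id]_(i <- r | P i) F i \o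
  \big[(fun f g : T -> T => f \o g)/id]_(i <- r | P i) G i.
Proof.
move=> FG; elim: r => [|i r IH]; first by rewrite !big_nil.
have FGr y : G i ((\big[(fun f g : T -> T => f \o g)/id]_(j <- r | P j) F j) y) =
    (\big[(fun f g : T -> T => f \o g)/id]_(j <- r | P j) F j) (G i y).
  elim: r {IH} y => [|j r IH] y; first by rewrite !big_nil.
  by rewrite !big_cons; case: (P j) => //=; rewrite -FG IH.
rewrite !big_cons; case: (P i) => //; rewrite IH.
by apply/funext => x /=; rewrite FGr.
Qed.

Lemma monomialD n (V : 'I_n -> mp_aut mu) (I : {set 'I_n}) p q :
  (forall i j x, V i (V j x) = V j (V i x)) ->
  monomial V I (fun i => p i + q i) = monomial V I p \o monomial V I q.
Proof.
move=> VC; rewrite -big_comp_split.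
  by apply: eq_bigr => i _; apply/funext => x; exact: aut_powD.
move=> i j x; apply: aut_pow_comm => y.
by apply/esym/aut_pow_comm => z; exact: VC.
Qed.

Lemma monomial_supp n (V : 'I_n -> mp_aut mu) (I : {set 'I_n}) p :
  (forall i, i \notin I -> p i = 0) ->
  monomial V [set: 'I_n]%SET p = monomial V I p.
Proof.
rewrite /monomial => p0; elim: index_enum => [|i r IH]; first by rewrite !big_nil.
rewrite !big_cons inE; case: ifPn => [_|/p0 ->]; rewrite IH//.
Qed.

(** The exponent [p - q] is supported in [I] and nonzero, so nonperiodicity applies to it; the
    coincidence set is the preimage of its fixed points under the monomial of exponent [q]. *)
Lemma monomial_eq_negligible n (V : 'I_n -> mp_aut mu) (I : {set 'I_n}) p q :
  (forall i j x, V i (V j x) = V j (V i x)) -> nonperiodic V I ->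
  (forall i, i \notin I -> p i = q i) -> (exists i, p i != q i) ->
  mu.-negligible [set x | monomial V [set: 'I_n]%SET p x =
                          monomial V [set: 'I_n]%SET q x].
Proof.
move=> VC Vnp pq [i0 pq0].
have i0I : i0 \in I by apply: contraNT pq0 => /pq ->.
have pB : p = (fun i => (p i - q i) + q i).
  by apply/funext => i; rewrite subrK.
have [W WE] := monomial_mp V [set: 'I_n]%SET q.
have /(mp_preimage_negligible W) : mu.-negligible
    [set x | monomial V I (fun i => p i - q i) x = x].
  by apply: Vnp; exists i0 => //; rewrite subr_eq0.
rewrite -(@monomial_supp _ V I); last by move=> i /pq ->; rewrite subrr.
apply: negligibleS => x /=.
by rewrite {1}pB (@monomialD _ _ _ (fun i => p i - q i) q)// WE.
Qed.

End group_action.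

(** * Covering almost all of the space by few translates under a free finite family *)

Section greedy_covering.
Context (d : measure_display) (T : measurableType d) (R : realType)
  (mu : probability T R).

Lemma negligible_countable_union (C : countType) (F : C -> set T) :
  (forall c, mu.-negligible (F c)) -> mu.-negligible (\bigcup_c F c).
Proof.
move=> F0.
apply: (@negligibleS _ _ _ _
  (\bigcup_k (if unpickle k is Some c then F c else set0))).
  by move=> x [c _ Fcx]; exists (pickle c) => //; rewrite pickleK.
apply: negligible_bigcup => k; case: unpickle => //.
exact: negligible_set0.
Qed.

(** For almost every x, each [phi j x] differs from x, hence some [A k] or its complement contains x
    but not [phi j x]. Choosing one such set for every j leaves only countably many patterns [c],
    and [BB c] collects the points with pattern [c]. *)
Lemma separating_sets (J : finType) (P : pred J) (phi : J -> mp_aut mu) :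
  countably_separated mu ->
  (forall j, P j -> mu.-negligible [set x | phi j x = x]) ->
  exists B : nat -> set T, [/\ forall k, measurable (B k),
    mu.-negligible (~` \bigcup_k B k) &
    forall k j x, P j -> B k x -> ~ B k (phi j x)].
Proof.
move=> [A [N [mA N0 AN]]] fix0.
pose AA (c : nat * bool) := if c.2 then A c.1 else ~` A c.1.
have mAA c : measurable (AA c).
  by rewrite /AA; case: c.2 => //; exact: measurableC.
pose BB (c : {ffun J -> nat * bool}) :=
  \bigcap_(j in [set` P]) (AA (c j) `&` phi j @^-1` (~` AA (c j))).
have mBB c : measurable (BB c).
  apply: fin_bigcap_measurable; first exact: finite_finset.
  move=> j Pj; apply: measurableI => //.
  by apply: mp_preimage_measurable; exact: measurableC.
exists (fun k => if unpickle k is Some c then BB c else set0); split.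
- by move=> k; case: unpickle.
- apply: (@negligibleS _ _ _ _ (N `|` \bigcup_j (phi j @^-1` N `|`
      (if P j then [set x | phi j x = x] else set0)))); last first.
    apply: negligibleU => //; apply: negligible_countable_union => j.
    apply: negligibleU; first exact: mp_preimage_negligible.
    by case: ifP => [/fix0//|_]; exact: negligible_set0.
  apply: subsetCl => x /not_orP[Nx] good.
  have /choice[c cP] : forall j, exists c, P j -> AA c x /\ ~ AA c (phi j x).
    move=> j.
    have [Pj|nPj] := boolP (P j); last by exists (0%N, true).
    apply: contrapT => none; apply: good; exists j => //; rewrite Pj.
    have [Nj|Nj] := pselect (N (phi j x)); [by left|right].
    apply: AN => // k; split => Ak; apply: contrapT => nAk; apply: none.
      by exists (k, false) => _; split => // /(_ Ak).
    by exists (k, true).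
  exists (pickle [ffun j => c j]) => //; rewrite pickleK => j Pj.
  by rewrite !ffunE; have [] := cP j Pj.
- move=> k j x Pj; case: unpickle => // c.
  by move=> /(_ j Pj)[_ /= nA] /(_ j Pj)[].
Qed.

Local Open Scope ereal_scope.

(** Double counting: pointwise bounds on the number of sets [A s] containing x integrate to bounds
    on the sum of the measures. *)
Lemma sum_measure_integral (S : finType) (A : S -> set T) (D : set T) :
  measurable D -> (forall s, measurable (A s)) ->
  \sum_s mu (A s `&` D) = \int[mu]_(x in D) (\sum_s \1_(A s) x)%:E.
Proof.
move=> mD mA; under eq_integral do rewrite -sumEFin.
rewrite ge0_integral_sum//.
- by apply: eq_bigr => s _; rewrite integral_indic.
- by move=> s; apply/measurable_EFinP; exact: measurable_indic.
Qed.

Lemma measurable_count (S : finType) (A : S -> set T) (D : set T) :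
  (forall s, measurable (A s)) ->
  measurable_fun D (fun x => \sum_s \1_(A s) x : R)%R.
Proof. by move=> mA; apply: measurable_sum => s; exact: measurable_indic. Qed.

Lemma count_ge0 (S : finType) (A : S -> set T) x :
  (0 <= \sum_s \1_(A s) x :> R)%R.
Proof. by apply: sumr_ge0. Qed.

Lemma le_count_measure (S : finType) (A : S -> set T) (D : set T) (c : R) :
  measurable D -> (forall s, measurable (A s)) -> (0 <= c)%R ->
  (forall x, D x -> c <= \sum_s \1_(A s) x)%R ->
  c%:E * mu D <= \sum_s mu (A s `&` D).
Proof.
move=> mD mA c0 cA; rewrite sum_measure_integral// -integral_cst//.
apply: ge0_le_integral => //.
by apply/measurable_EFinP; exact: measurable_count.
Qed.

Lemma ge_count_measure (S : finType) (A : S -> set T) (D : set T) (c : R) :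
  measurable D -> (forall s, measurable (A s)) -> (0 <= c)%R ->
  (forall x, D x -> \sum_s \1_(A s) x <= c)%R ->
  \sum_s mu (A s `&` D) <= c%:E * mu D.
Proof.
move=> mD mA c0 cA; rewrite sum_measure_integral// -integral_cst//.
apply: ge0_le_integral => //.
- by move=> x _; rewrite lee_fin count_ge0.
- by apply/measurable_EFinP; exact: measurable_count.
Qed.

Lemma measure_finType_union (S : finType) (F : S -> set T) :
  (forall s, measurable (F s)) ->
  (forall s t x, s != t -> F s x -> ~ F t x) ->
  mu (\bigcup_s F s) = \sum_s mu (F s).
Proof.
move=> mF Fdisj.
have -> : \bigcup_s F s = \bigcup_(s in [set` predT]) F s.
  by apply/seteqP; split => x [s _ Fsx]; exists s.
rewrite measure_fin_bigcup//.
- rewrite -(@bigfs _ _ _ _ (index_enum S)) ?index_enum_uniq// => s _.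
  by rewrite mem_index_enum.
- move=> s t _ _ [x [Fs Ft]]; apply/eqP/negP => /negP st.
  exact: Fdisj st Fs Ft.
Qed.

(* Run through countably many sets [B k] for which the points [(g s)^-1 x], with
   [s] in [S] and [x] in [B k], are pairwise distinct, and each time add to [E] the points [x] of [B k] for which
   at least theta |S| of the points [(g s)^-1 x] are still uncovered. Each step
   covers theta |S| times the measure that it adds, and in the end
   almost no x has theta |S| uncovered points. *)
Lemma greedy_covering (S : finType) (g : S -> mp_aut mu) (theta : R) :
  countably_separated mu -> (0 < theta)%R -> (0 < #|S|)%N ->
  (forall s t, s != t -> mu.-negligible [set x | g s x = g t x]) ->
  exists E : set T, [/\ measurable E,
    mu E <= ((theta * #|S|%:R)^-1)%:E &
    mu (~` \bigcup_s (g s @^-1` E)) <= theta%:E].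
Proof.
move=> sep theta0 S0 gfree.
have [|B [mB Bcov Bsep]] := @separating_sets (S * S)%type
    [pred j | j.1 != j.2] (fun j => mp_comp (g j.1) (mp_inv (g j.2))) sep.
  move=> [s t]/= st.
  apply: negligibleS (mp_preimage_negligible (mp_inv (g t)) (gfree _ _ st)).
  by move=> x /=; rewrite aut_invK.
pose cov E := \bigcup_s (g s @^-1` E).
have mcov E : measurable E -> measurable (cov E).
  move=> mE; apply: fin_bigcup_measurable; first exact: finite_finset.
  by move=> s _; exact: mp_preimage_measurable.
have covS E F : E `<=` F -> cov E `<=` cov F.
  by move=> EF x [s _ Egx]; exists s => //; exact: EF.
pose c : R := (theta * #|S|%:R)%R.
have c0 : (0 < c)%R by rewrite mulr_gt0// ltr0n.
pose A E s := mp_inv (g s) @^-1` (~` cov E).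
have mA E s : measurable E -> measurable (A E s).
  by move=> mE; apply: mp_preimage_measurable; exact/measurableC/mcov.
pose D E k := B k `&` [set x | c <= \sum_s \1_(A E s) x]%R.
have mD E k : measurable E -> measurable (D E k).
  move=> mE; apply: measurable_fun_le => //.
  by apply: measurable_count => s; exact: mA.
pose EE := fix EE k := if k is k'.+1 then EE k' `|` D (EE k') k' else set0.
have mEE k : measurable (EE k).
  by elim: k => //= k IH; apply: measurableU => //; exact: mD.
have EEcov k : c%:E * mu (EE k) <= mu (cov (EE k)).
  elim: k => [|k IH]; first by rewrite /= measure0 mule0.
  set Dk := D (EE k) k.
  have mDk : measurable Dk by exact: mD.
  have := @le_count_measure S (A (EE k)) Dk c mDk
    (fun s => mA _ s (mEE k)) (ltW c0) (fun x Dx => Dx.2).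
  (* Pulled back by [g s], the sets become the newly covered regions. They are disjoint for
     different s: a common point x would put both [g s x] and its image [g t x] under [g t] composed
     with the inverse of [g s] into [B k], against [Bsep]. *)
  have AE s : mu (A (EE k) s `&` Dk) = mu (~` cov (EE k) `&` g s @^-1` Dk).
    rewrite -(aut_preserving (g s)); last by apply: measurableI => //; exact: mA.
    congr (mu _); apply/seteqP; split => x /= [];
      by rewrite /A /= aut_funK.
  under eq_bigr do rewrite AE.
  rewrite -measure_finType_union; last 2 first.
  - move=> s; apply: measurableI; first exact/measurableC/mcov.
    exact: mp_preimage_measurable.
  - move=> s t x st [_ /= [Bs _]] [_ /= [Bt _]].
    apply: (Bsep k (t, s) (g s x)) => //=; first by rewrite eq_sym.
    by rewrite aut_funK.
  set F := \bigcup_s _ => DF.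
  have mF : measurable F.
    apply: fin_bigcup_measurable; first exact: finite_finset.
    move=> s _; apply: measurableI; first exact/measurableC/mcov.
    exact: mp_preimage_measurable.
  have disj : cov (EE k) `&` F = set0.
    by apply/seteqP; split => // x [cx [s _ [ncx _]]].
  apply: (@le_trans _ _ (mu (cov (EE k) `|` F))); last first.
    apply: le_measure; rewrite ?inE.
    - by apply: measurableU => //; exact: mcov.
    - exact: mcov.
    - move=> x [|[s _ [_ Ds]]]; first by apply: covS => y; left.
      by exists s => //; right.
  rewrite (measureU mu (mcov _ (mEE k)) mF disj).
  apply: le_trans (leeD IH DF).
  rewrite -ge0_muleDr ?measure_ge0//.
  by apply: lee_wpmul2l; [rewrite lee_fin ltW|exact: measureU2].
pose E := \bigcup_k EE k.
have mE : measurable E by apply: bigcup_measurable => k _.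
have EEE k : EE k `<=` E by move=> x; exists k.
exists E; split => //.
  (* By [EEcov], [c] times [mu (EE k)] is at most 1 for every k; the bound passes to the limit. *)
  have /cvge_to_le : mu \o EE @ \oo --> mu E.
    apply: nondecreasing_cvg_mu => //; apply/nondecreasing_seqP => k.
    by apply/subsetPset; exact: subsetUl.
  apply; apply: nearW => k /=.
  rewrite -[leRHS]mule1 lee_pdivlMl//.
  apply: le_trans (EEcov k) _.
  by apply: probability_le1; exact: mcov.
set W := ~` _.
have mW : measurable W by exact: (measurableC (mcov _ mE)).
have mCB : measurable (\bigcup_k B k) by apply: bigcup_measurable.
(* Each s contributes one copy of [mu W], so the sum over s is [#|S|] times [mu W], to be compared
   with [c = theta * #|S|]. *)
have muW s : mu W = mu (A E s `&` \bigcup_k B k).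
  rewrite -(aut_inv_preserving (g s) mW).
  rewrite (_ : aut_inv _ @^-1` W = A E s)//.
  rewrite [LHS](measureDI mu (mA _ s mE) mCB) [X in X + _](_ : _ = 0) ?add0e//.
  apply/negligibleP; first by apply: measurableD => //; exact: mA.
  by apply: negligibleS Bcov => x [].
have : \sum_s mu (A E s `&` \bigcup_k B k) <= c%:E * mu (\bigcup_k B k).
  apply: ge_count_measure => //.
  - by move=> s; exact: mA.
  - exact: ltW.
  move=> x [k _ Bkx].
  (* Either x was added to [E] at step k, and then its count is 0, or its count was already below
     [c] at step k and can only decrease as [E] grows. *)
  have [cx|cx] := leP c (\sum_s \1_(A (EE k) s) x)%R.
    have Ex : E x by exists k.+1 => //; right.
    rewrite big1 ?(ltW c0)// => s _; rewrite indicE memNset//=.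
    by apply; exists s => //=; rewrite aut_invK.
  apply: le_trans (ltW cx); apply: ler_sum => s _.
  rewrite !indicE; have [xA|_] := boolP (x \in A E s); last exact: ler0n.
  rewrite mem_set//; move: xA; rewrite inE; apply: contra_not.
  exact: covS.
under eq_bigr do rewrite -muW.
move=> /le_trans /(_ (lee_wpmul2l _ (probability_le1 mu mCB))).
rewrite lee_fin ltW// mule1 => /(_ isT).
have <- : (fine (mu W))%:E = mu W by rewrite fineK// fin_num_measure.
rewrite sumEFin sumr_const !lee_fin /c -[leLHS]mulr_natr.
by rewrite ler_pM2r ?ltr0n.
Qed.

End greedy_covering.

(** * Counting boxes of bounded volume by harmonic sums *)

Section counting.
Context (R : realType).

(** Telescoping, with [ln (1 + 1/k) <= 1/k]. *)
Lemma ln_le_harmonic (N B : nat) : (0 < N)%N -> (N <= B)%N ->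
  ln B%:R - ln N%:R <= \sum_(k < B | (N <= k)%N) k%:R^-1 :> R.
Proof.
move=> N0 NB.
have -> : \sum_(k < B | (N <= k)%N) k%:R^-1 = \sum_(N <= k < B) k%:R^-1 :> R.
  by rewrite big_geq_mkord.
rewrite -(@telescope_sumr _ N B (fun k => ln k%:R : R))//.
apply: ler_sum_nat => k /andP[Nk kB].
have k0 : (0 < k%:R :> R) by rewrite ltr0n (leq_trans N0).
rewrite -ln_div ?posrE// ?ltr0n// -addn1 natrD mulrDl divff ?gt_eqF// mul1r.
by rewrite le_ln1Dx// (lt_trans (ltrN10 R))// invr_gt0.
Qed.

(** The integer quotient q is at least 1, so D < (q + 1) P <= 2 q P. *)
Lemma half_quotient_le_divn (D P : nat) : (0 < P)%N -> (P <= D)%N ->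
  D%:R / 2 / P%:R <= (D %/ P)%:R :> R.
Proof.
move=> P0 PD; rewrite ler_pdivrMr ?ltr0n// ler_pdivrMr//.
rewrite -!natrM ler_nat.
have := ltn_ceil D P0; have : (0 < D %/ P)%N by rewrite divn_gt0.
nia.
Qed.

(** With the summand 1, a bound on the cost [(Phi M + 1) * mu E] also bounds [mu E], as
    Borel-Cantelli will require. *)
Lemma eventually_dominated (Phi : R -> R) (m : nat) (eps : R) :
  0 < eps -> (forall t, 0 <= t -> 0 <= Phi t) ->
  Phi =o_ (pinfty_nbhs R) (fun t : R => t * ln t ^+ m) ->
  exists M0, forall M, M0 <= M -> Phi M + 1 <= eps * (M * ln M ^+ m).
Proof.
move=> eps0 Phi0 /eqoP/(_ (eps / 2)); rewrite divr_gt0// => /(_ isT).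
move=> [M1 [_ PhiM]].
(* From [expR 1] on, [ln M >= 1]; from [2 / eps] on, half of the right-hand side absorbs the summand
   1. *)
exists (Num.max (M1 + 1) (Num.max (expR 1) (2 / eps))) => M.
rewrite !ge_max => /and3P[M1M eM epsM].
have M0 : 0 < M by apply: lt_le_trans eM; exact: expR_gt0.
have lnM : 1 <= ln M by rewrite -(expRK 1) ler_ln ?posrE ?expR_gt0.
have lnm : 1 <= ln M ^+ m by exact: exprn_ege1.
have MlnM : 0 <= M * ln M ^+ m by rewrite mulr_ge0 ?(ltW M0)// (le_trans _ lnm).
have /PhiM : M1 < M by apply: lt_le_trans M1M; rewrite ltrDl.
rewrite /= !ger0_norm ?Phi0 ?(ltW M0)// => {}PhiM.
have M_ge : 1 <= eps / 2 * M by rewrite -ler_pdivrMl ?divr_gt0// mulr1 invf_div.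
have := ler_pM ler01 ler01 M_ge lnm.
rewrite mul1r -(mulrA (eps / 2)) => oneM.
by rewrite [X in _ <= X * _]splitr mulrDl lerD.
Qed.

Lemma many_boxes (n N : nat) (I : {set 'I_n}) (i0 : 'I_n) (Phi : R -> R)
    (eps : R) :
  i0 \in I -> (0 < N)%N -> 0 < eps -> (forall t, 0 <= t -> 0 <= Phi t) ->
  Phi =o_ (pinfty_nbhs R) (fun t : R => t * ln t ^+ #|I|.-1) ->
  exists (S : finType) (s : S -> 'I_n -> nat) (M : R), 0 <= M /\
  [/\ forall a b, a != b -> exists i, s a i != s b i,
      forall a i, i \notin I -> s a i = N,
      forall a i, (N <= s a i)%N,
      forall a, N%:R * \prod_i (s a i)%:R <= M &
      Phi M + 1 <= eps * #|S|%:R].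
Proof.
move=> i0I N0 eps0 Phi0 Phio.
pose J := (I :\ i0)%SET; pose m := #|I|.-1.
have cJ : #|J| = m by rewrite /m (cardsD1 i0 I) i0I.
(* [C] collects all losses: [4 * N] from comparing [M] with [D / 2], a factor [N] for each index
   outside [J], and [2 * n.+1] from comparing [ln M] with [ln B / 2]. *)
pose C : R := 4 * N%:R ^+ #|~: J|.+1 * (2 * n.+1%:R) ^+ m.
have C0 : 0 < C.
  by rewrite !mulr_gt0// ?exprn_gt0// ?mulr_gt0 ?ltr0n.
have [M0 PhiM] := eventually_dominated (divr_gt0 eps0 C0) Phi0 Phio.
(* [B >= N ^ 2] makes the harmonic sum from [N] to [B] at least [ln B / 2]; [B >= 2 * N ^ 2] gives
   [M <= B ^ n.+1]; and [M >= B >= M0]. *)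
pose B := (2 * N ^ 2 + Num.truncn M0).+1.
(* [D] dominates [N] times the product of the other sides, so a side [N + r] gives volume at most
   [2 * D], whence the choice of [M]. *)
pose D := (N * B ^ n)%N.
pose M : R := (2 * N * D)%:R.
have NB : (N < B)%N by rewrite /B; nia.
have B0 : (0 < B)%N by [].
have n0 : (0 < n)%N by apply: leq_ltn_trans (ltn_ord i0).
have BM : (B <= 2 * N * D)%N.
  have : (B <= B ^ n)%N by rewrite -{1}(expn1 B) leq_pexp2l.
  by rewrite /D; nia.
have M0M : M0 <= M.
  apply: (@le_trans _ _ B%:R); last by rewrite ler_nat.
  apply/ltW/(lt_le_trans (real_truncnS_gt (num_real M0))).
  by rewrite ler_nat /B; lia.
pose prest (v : {ffun 'I_n -> 'I_B}) := (\prod_(i | i != i0) v i)%N.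
pose Q (i : 'I_n) (k : 'I_B) := if i \in J then (N <= k)%N else k == N :> nat.
(* The sides other than [i0] are given by a function in [family Q] whose value
   at [i0] is a dummy [N], and the side [i0] is [N + r] with
   [r < D / (product of the other sides)]. Summing [D / (product)] over the family
   yields the (d-1)-st power of a harmonic sum. *)
pose P (x : {ffun 'I_n -> 'I_B} * 'I_D) :=
  (x.1 \in family Q) && (x.2 < D %/ prest x.1)%N.
pose s (x : {x | P x}) (i : 'I_n) : nat :=
  if i == i0 then (N + (val x).2)%N else (val x).1 i.
have QN i k : Q i k -> (N <= k)%N by rewrite /Q; case: ifP => // _ /eqP ->.
have QJ i k : i \notin J -> Q i k -> k = N :> nat.
  by rewrite /Q => /negbTE -> /eqP.
have i0J : i0 \notin J by rewrite !inE eqxx.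
have prest_gt0 v : v \in family Q -> (0 < prest v)%N.
  move=> /familyP vQ; apply: prodn_cond_gt0 => i _.
  exact: leq_trans N0 (QN _ _ (vQ i)).
have prest_le v : (prest v <= B ^ n)%N.
  apply: (@leq_trans (\prod_(i < n | i != i0) B)).
    by apply: leq_prod => i _; exact: ltnW.
  rewrite prod_nat_const leq_pexp2l//.
  by rewrite -[leqRHS](card_ord n) max_card.
exists {x | P x}, s, M; split; [exact: ler0n|split].
- move=> [[v r] Px] [[w r'] Py] ab; apply: contrapT => /forallNP sE.
  have {}sE i : s (exist _ (v, r) Px) i = s (exist _ (w, r') Py) i.
    by apply/eqP/negPn/negP/sE.
  have /andP[/familyP/= vQ _] := Px; have /andP[/familyP/= wQ _] := Py.
  move/eqP: ab; apply; apply: val_inj => /=; congr (_, _); last first.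
    by have := sE i0; rewrite /s/= eqxx => /addnI/val_inj.
  apply/ffunP => i; apply: val_inj; have := sE i; rewrite /s/=.
  case: eqVneq => // -> _.
  by rewrite (QJ _ _ i0J (vQ i0)) (QJ _ _ i0J (wQ i0)).
- move=> [[v r] Px] i iI; have /andP[/familyP/= vQ _] := Px; rewrite /s/=.
  have iJ : i \notin J by rewrite !inE negb_and iI orbT.
  have -> : (i == i0) = false by apply: contraNF iI => /eqP ->.
  exact: QJ iJ (vQ i).
- move=> [[v r] Px] i; have /andP[/familyP/= vQ _] := Px; rewrite /s/=.
  by case: ifP => _; [rewrite leq_addr|exact: QN (vQ i)].
- move=> [[v r] Px]; rewrite /s /M.
  have /andP[/= vQ rD] := Px.
  rewrite (bigD1 i0)//= eqxx.
  rewrite (eq_bigr (fun i => (v i)%:R)); last by move=> i /negbTE ->.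
  rewrite -natr_prod -!natrM ler_nat -/(prest v).
  have := leq_trans (leq_mul (ltnW rD) (leqnn (prest v))) (leq_divM _ _).
  have := prest_le v; rewrite /D; nia.
- apply: le_trans (PhiM M M0M) _.
  pose H : R := \sum_(k < B | (N <= k)%N) k%:R^-1.
  (* The weight 1 at the dummy coordinate [i0] makes the full product equal to the inverse of
     [prest v]. *)
  pose F (i : 'I_n) (k : 'I_B) : R := if i == i0 then 1 else k%:R^-1.
  have F0 i k : 0 <= F i k by rewrite /F; case: ifP.
  have cardP : #|{: {x | P x}}|%:R = \sum_(v in family Q) (D %/ prest v)%:R :> R.
    rewrite card_sig -sum1_card -natr_sum; congr _%:R.
    rewrite -(pair_big_dep (mem (family Q)) (fun v (r : 'I_D) => (r < D %/ prest v)%N)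
      (fun _ _ => 1%N)) /=.
    apply: eq_bigr => v _; rewrite -(big_ord_widen _ (fun=> 1%N)) ?leq_div//.
    by rewrite sum1_card card_ord.
  have prodF (v : {ffun 'I_n -> 'I_B}) : \prod_i F i (v i) = (prest v)%:R^-1.
    rewrite (bigD1 i0)//= {1}/F eqxx mul1r natr_prod -prodfV.
    by apply: eq_bigr => i /negbTE ii0; rewrite /F ii0.
  have HB : ln B%:R / 2 <= H.
    apply: le_trans (ln_le_harmonic N0 (ltnW NB)).
    have : ln (N%:R ^+ 2) <= ln B%:R :> R.
      rewrite ler_ln ?posrE ?exprn_gt0 ?ltr0n// -natrX ler_nat /B; lia.
    rewrite lnXn ?ltr0n// mulr2n; lra.
  have lnM : ln M <= n.+1%:R * ln B%:R.
    rewrite mulr_natl -lnXn ?ltr0n// ler_ln ?posrE ?exprn_gt0 ?ltr0n//.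
      by rewrite /M -natrX ler_nat expnS /D mulnA leq_mul// /B; lia.
    exact: leq_trans BM.
  have lnB0 : 0 <= ln B%:R :> R by rewrite ln_ge0// ler1n.
  have lnM0 : 0 <= ln M by rewrite ln_ge0// ler1n (leq_trans _ BM).
  (* Indices in [J] contribute a harmonic sum; every other index has the single value [N],
     contributing 1 at [i0] and [1 / N] elsewhere. *)
  have prodH : N%:R^-1 ^+ #|~: J| * (ln B%:R / 2) ^+ m <=
      \prod_i \sum_(k | Q i k) F i k.
    apply: (@le_trans _ _ (\prod_i (if i \in J then ln B%:R / 2 else N%:R^-1))).
      rewrite big_if /= [leRHS]mulrC [X in _ <= _ * X]prodr_const cJ.
      rewrite [X in _ <= X * _](eq_bigl (mem (~: J)%SET)); last first.
        by move=> i; rewrite !inE.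
      by rewrite prodr_const.
    apply: ler_prod => i _; rewrite [X in X && _](_ : _ = true); last first.
      by case: ifP => _; rewrite ?invr_ge0 ?divr_ge0 ?ler0n.
    have [iJ|iJ] := boolP (i \in J).
      have ii0 : (i == i0) = false by apply/negbTE; move: iJ; rewrite !inE => /andP[].
      apply: le_trans HB _; rewrite /H le_eqVlt; apply/orP; left; apply/eqP.
      by apply: eq_big => k; rewrite /Q ?iJ// /F ii0.
    rewrite (bigD1 (Ordinal NB))/=; last by rewrite /Q (negbTE iJ).
    apply: ler_wpDr; first by apply: sumr_ge0.
    by rewrite /F; case: ifP => // _; rewrite invf_le1 ?ler1n ?ltr0n.
  rewrite cardP.
  have cardH : D%:R / 2 * (N%:R^-1 ^+ #|~: J| * (ln B%:R / 2) ^+ m) <=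
      \sum_(v in family Q) (D %/ prest v)%:R :> R.
    apply: (@le_trans _ _ (\sum_(v in family Q) D%:R / 2 * (prest v)%:R^-1)).
      rewrite -mulr_sumr ler_wpM2l// (le_trans prodH)// bigA_distr_big_dep/=.
      by rewrite le_eqVlt; apply/orP; left; apply/eqP/eq_bigr => v _; rewrite prodF.
    apply: ler_sum => v vQ; apply: half_quotient_le_divn; first exact: prest_gt0.
    by apply: leq_trans (prest_le v) _; rewrite /D leq_pmull.
  apply: le_trans (ler_wpM2l (ltW eps0) cardH).
  rewrite -!mulrA ler_wpM2l ?(ltW eps0)//.
  rewrite mulrC ler_pdivrMr//.
  apply: (@le_trans _ _ (M * (n.+1%:R * ln B%:R) ^+ m)).
    by rewrite ler_wpM2l// lerXn2r ?nnegrE ?mulr_ge0.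
  rewrite le_eqVlt; apply/orP; left; apply/eqP.
  rewrite /M /C !natrM !exprMn !exprVn exprS; field.
rewrite !gt_eqF ?exprn_gt0 ?ltr0n//.
Qed.

End counting.

(** * The function built from the peaks, and lower bounds for its averages *)

Section divergence.
Context (d : measure_display) (T : measurableType d) (R : realType)
  (mu : probability T R).

(** A maximum rather than a sum: its value is 0 or a single [M i], so [Phi] of it is controlled
    without any subadditivity of [Phi]. *)
Fixpoint peak_max (E : nat -> set T) (M : nat -> R) (k : nat) (x : T) : R :=
  if k is k'.+1 then Num.max (peak_max E M k' x) (M k' * \1_(E k') x) else 0.

Lemma peak_max_measurable E M k :
  (forall i, measurable (E i)) -> measurable_fun setT (peak_max E M k).
Proof.
move=> mE; elim: k => [|k IH]; first exact: measurable_cst.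
by apply: measurable_maxr => //; apply: measurable_funM.
Qed.

Lemma peak_max_ge0 E M k x : 0 <= peak_max E M k x.
Proof. by elim: k => //= k IH; rewrite le_max IH. Qed.

Lemma peak_max_ge E M k i x : (i < k)%N -> E i x -> M i <= peak_max E M k x.
Proof.
move=> ik Eix; elim: k ik => // k IH; rewrite ltnS leq_eqVlt => /predU1P[<-|ik].
  by rewrite /= le_max indicE mem_set//= mulr1 lexx orbT.
by rewrite /= le_max IH.
Qed.

Lemma Phi_peak_max E M k x (Phi : R -> R) :
  (forall t, 0 <= t -> 0 <= Phi t) -> (forall i, 0 <= M i) ->
  Phi (peak_max E M k x) <= Phi 0 + \sum_(0 <= i < k) Phi (M i) * \1_(E i) x.
Proof.
move=> Phi0 M0; elim: k => [|k IH]; first by rewrite /= big_geq// addr0.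
have Ek : 0 <= Phi (M k) * \1_(E k) x by rewrite mulr_ge0 ?Phi0.
rewrite big_nat_recr//= addrA /Num.max; case: ifPn => _; last first.
  by rewrite (le_trans IH)// lerDl.
rewrite indicE; case: (x \in E k) Ek; rewrite /= ?mulr1 ?mulr0 => Ek.
  rewrite lerDr addr_ge0 ?Phi0// sumr_ge0// => i _.
  by rewrite mulr_ge0 ?Phi0.
by rewrite addr0 lerDl sumr_ge0// => i _; rewrite mulr_ge0 ?Phi0.
Qed.

(** The measures [mu (E k)] are summable, so by Borel-Cantelli almost every x lies in finitely many
    [E k] and the maxima stabilise there; on the null set [N] the function is set to 0. *)
Lemma exists_peak_function (Phi : R -> R) (E : nat -> set T) (M : nat -> R) :
  (forall t, 0 <= t -> 0 <= Phi t) ->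
  (forall t u, 0 <= t -> t <= u -> Phi t <= Phi u) ->
  (forall k, measurable (E k)) -> (forall k, 0 <= M k) ->
  (\sum_(k <oo) (Phi (M k) + 1)%:E * mu (E k) < +oo)%E ->
  exists (f : T -> R) (N : set T),
    [/\ forall x, 0 <= f x, in_LPhi mu Phi f, mu.-negligible N &
        forall k x, ~ N x -> E k x -> M k <= f x].
Proof.
move=> Phi0 Phind mE M0 EM.
have PhiM0 k : 0 <= Phi (M k) by rewrite Phi0.
pose N := lim_sup_set E.
have mN : measurable N.
  by apply: bigcapT_measurable => k; exact: bigcup_measurable.
have N0 : mu N = 0.
  apply: lim_sup_set_cvg0 => //; apply: le_lt_trans EM.
  apply: lee_nneseries => [k _ _|k _]; first exact: measure_ge0.
  by rewrite lee_pemull ?measure_ge0// lee_fin lerDr.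
pose f_ k x := peak_max E M k x * \1_(~` N) x.
have f_stable x : exists k0, forall k, (k0 <= k)%N -> f_ k x = f_ k0 x.
  rewrite /f_ indicE; have [Nx|Nx] := boolP (x \in ~` N); last first.
    by exists 0%N => k _; rewrite !mulr0.
  have : exists k0, forall k, (k0 <= k)%N -> ~ E k x.
    move: Nx; rewrite inE => Nx; apply: contrapT => /forallNP k0E; apply: Nx.
    move=> k0 _; have /existsNP[k /not_implyP[k0k /contrapT Ekx]] := k0E k0.
    by exists k.
  move=> [k0 k0E]; exists k0 => k k0k; congr (_ * _).
  elim: k k0k => [|k IH]; first by rewrite leqn0 => /eqP ->.
  rewrite leq_eqVlt => /predU1P[-> //|]; rewrite ltnS => k0k /=.
  rewrite indicE memNset ?mulr0; last exact: k0E.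
  by rewrite max_l ?peak_max_ge0// IH.
have [k0_ f_k0] := choice f_stable.
pose f x := f_ (k0_ x) x.
have f_cvg x : f_ ^~ x @ \oo --> f x.
  by apply: cvg_near_cst; exists (k0_ x) => // k /= /f_k0.
have f0 x : 0 <= f x by rewrite mulr_ge0 ?peak_max_ge0.
have mf : measurable_fun setT f.
  apply: (measurable_fun_cvg (h := f_)) => [k|x _]; last exact: f_cvg.
  apply: measurable_funM; first exact: peak_max_measurable.
  by apply: measurable_indic; exact: measurableC.
have mPhi : measurable_fun setT (fun x => Phi `|f x|).
  (* [Phi] is monotone only on nonnegative reals; [Psi] is monotone everywhere, hence measurable. *)
  pose Psi t := Phi (Num.max t 0).
  rewrite (_ : (fun x => _) = Psi \o f); last first.
    by apply/funext => x; rewrite /= /Psi max_l// ger0_norm.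
  apply: measurableT_comp => //; apply: nondecreasing_measurable => //.
  move=> t u tu; apply: Phind; first by rewrite le_max lexx orbT.
  by rewrite ge_max !le_max tu lexx orbT.
exists f, N; split => //; last 2 first.
- by exists N; split.
- move=> k x Nx Ekx; rewrite /f -(f_k0 x (maxn k.+1 (k0_ x))) ?leq_maxr//.
  rewrite /f_ indicE mem_set//= mulr1.
  by apply: peak_max_ge => //; rewrite leq_maxl.
split => //; apply/integrableP; split; first exact/measurable_EFinP.
have m1 k : measurable_fun setT (fun x => (Phi (M k) * \1_(E k) x)%:E).
  apply/measurable_EFinP/measurable_funM => //; exact: measurable_indic.
have p1 k x : (0 <= (Phi (M k) * \1_(E k) x)%:E)%E.
  by rewrite lee_fin mulr_ge0.
apply: (@le_lt_trans _ _ (\int[mu]_x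
    ((Phi 0)%:E + \sum_(k <oo) (Phi (M k) * \1_(E k) x)%:E))%E).
  apply: ge0_le_integral => //.
  - by apply: measurableT_comp => //; exact/measurable_EFinP.
  - apply: emeasurable_funD => //.
    by apply: ge0_emeasurable_sum.
  move=> x _; rewrite (ger0_norm (f0 x)) gee0_abs ?lee_fin ?Phi0//.
  apply: (@le_trans _ _ ((Phi 0)%:E +
      \sum_(0 <= i < k0_ x) (Phi (M i) * \1_(E i) x)%:E)%E); last first.
    by apply: leeD2l; apply: nneseries_lim_ge.
  rewrite sumEFin -EFinD lee_fin.
  rewrite /f /f_ indicE; case: (x \in _); first by rewrite /= mulr1 Phi_peak_max.
  by rewrite mulr0 lerDl sumr_ge0// => i _; rewrite mulr_ge0.
rewrite ge0_integralD//; last 3 first.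
- by move=> x _; rewrite lee_fin Phi0.
- by move=> x _; apply: nneseries_ge0.
- by apply: ge0_emeasurable_sum.
rewrite integral_cst//.
rewrite [X in (_ * X)%E](_ : _ = 1%E); last exact: (probability_setT mu).
rewrite mule1 lte_add_pinfty ?ltry//.
rewrite integral_nneseries//.
apply: le_lt_trans EM; apply: lee_nneseries => [k _ _|k _].
  by apply: integral_ge0 => x _.
rewrite (@integralZl_indic _ _ _ mu setT measurableT (fun=> E k))//; last first.
  by rewrite ltNge PhiM0.
rewrite integral_indic// setIT lee_wpmul2r ?measure_ge0//.
by rewrite lee_fin lerDl.
Qed.

Lemma ergodic_avg_ge n (U : 'I_n -> mp_aut mu) (f : T -> R) (s : 'I_n -> nat) x :
  (forall x, 0 <= f x) -> (forall i, (0 < s i)%N) ->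
  f (monomial U [set: 'I_n]%SET (fun i => Posz (s i).-1) x) /
    \prod_i (s i)%:R <= ergodic_avg U f s x.
Proof.
move=> f0 s0; rewrite /ergodic_avg mulrC ler_wpM2l//.
  by rewrite invr_ge0 prodr_ge0.
have s1 i : ((s i).-1 < s i)%N by rewrite ltn_predL.
pose j : {dffun forall i : 'I_n, 'I_(s i)} := [ffun i => Ordinal (s1 i)].
rewrite (bigD1 j)//=.
rewrite (_ : (fun i => Posz (j i)) = (fun i => Posz (s i).-1)).
  by rewrite lerDl sumr_ge0.
by apply/funext => i; rewrite ffunE.
Qed.

(** The exponents are [(s i).-1] because the sums stop there. If f >= M at that point of [E], the
    average over the box is at least [N]. *)
Definition covered n (U : 'I_n -> mp_aut mu) (N : nat) (E : set T) (M : R) x :=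
  exists s : 'I_n -> nat, [/\ forall i, (N <= s i)%N,
    N%:R * \prod_i (s i)%:R <= M &
    E (monomial U [set: 'I_n]%SET (fun i => Posz (s i).-1) x)].

Lemma exists_peak_set n (U : 'I_n -> mp_aut mu) (I : {set 'I_n}) (Phi : R -> R)
    (N : nat) (delta : R) :
  countably_separated mu ->
  (forall i j x, U i (U j x) = U j (U i x)) -> nonperiodic U I ->
  (0 < #|I|)%N -> (forall t, 0 <= t -> 0 <= Phi t) ->
  Phi =o_ (pinfty_nbhs R) (fun t : R => t * ln t ^+ #|I|.-1) ->
  (0 < N)%N -> 0 < delta ->
  exists E M W, [/\ measurable E /\ measurable W, 0 <= M,
    ((Phi M + 1)%:E * mu E <= delta%:E)%E, (mu W <= delta%:E)%E &
    forall x, ~ W x -> covered U N E M x].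
Proof.
move=> sep UC Unp /card_gt0P[i0 i0I] Phi0 Phio N0 delta0.
(* With [theta = delta] the cost is at most [delta ^+ 2 * #|S|] divided by [delta * #|S|], that is
   [delta]. *)
have delta2 : 0 < delta ^+ 2 by rewrite exprn_gt0.
have [S [s [M [M0 [s_inj sI sN sM cardS]]]]] :=
  many_boxes i0I N0 delta2 Phi0 Phio.
have PhiM : 0 < Phi M + 1 by rewrite ltr_wpDl ?Phi0.
have S0 : (0 < #|S|)%N.
  by rewrite -(ltr0n R) -(pmulr_rgt0 _ delta2) (lt_le_trans PhiM).
have /choice[g gE] := fun a => monomial_mp U [set: 'I_n]%SET
  (fun i => Posz (s a i).-1).
have gfree a b : a != b -> mu.-negligible [set x | g a x = g b x].
  move=> ab; rewrite !gE; apply: (monomial_eq_negligible UC Unp) => [i iI|].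
    by rewrite !sI.
  (* The sides are at least [N > 0], so taking predecessors keeps distinct boxes distinct. *)
  have [i sab] := s_inj _ _ ab; exists i; apply: contra_neq sab => -[].
  by have := sN a i; have := sN b i; lia.
have [E [mE muE muW]] := greedy_covering sep delta0 S0 gfree.
exists E, M, (~` \bigcup_a (g a @^-1` E)); split => //.
- split => //; apply: measurableC.
  apply: fin_bigcup_measurable; first exact: finite_finset.
  by move=> a _; exact: mp_preimage_measurable.
- apply: le_trans (lee_wpmul2l _ muE) _; first by rewrite lee_fin ltW.
  rewrite -EFinM lee_fin ler_pdivrMr ?mulr_gt0 ?ltr0n//.
  by rewrite mulrA -expr2.
- move=> x /contrapT[a _ Ex]; exists (s a); split => //.
  by rewrite -gE.
Qed.

Lemma negligible_of_le_half_pow (A : set T) (n : nat) : measurable A ->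
  (forall k, (n <= k)%N -> (mu A <= ((1 / (2 ^ k.+1)%:R))%:E)%E) ->
  mu.-negligible A.
Proof.
move=> mA muA; apply/negligibleP => //; change (mu A = 0%E).
have /fineK muAE : mu A \is a fin_num by rewrite fin_num_measure.
apply/eqP; rewrite eq_le measure_ge0 andbT leNgt -muAE lte_fin.
apply/negP => A0; pose k := maxn n (Num.bound (fine (mu A))^-1).
have := muA k (leq_maxl _ _); rewrite -muAE lee_fin leNgt => /negP; apply.
rewrite div1r invf_plt ?posrE// natrX.
by apply: upper_nthrootP; rewrite leqW// leq_maxr.
Qed.

End divergence.

(** * Assembly of the stages and divergence almost everywhere *)

Theorem mainTheorem4 (disp : measure_display) (X : measurableType disp)
    (R : realType) (mu : probability X R)
    (hsep : countably_separated mu)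
    (n d : nat) (U : 'I_n -> mp_aut mu)
    (hcomm : forall (i j : 'I_n) (x : X), U i (U j x) = U j (U i x))
    (hd : (1 <= d)%N) (hrank : aut_rank U = d)
    (hnonper : exists I : {set 'I_n},
        [/\ #|I| = d, independent U I & nonperiodic U I])
    (Phi : R -> R)
    (hPhi_ge0 : forall t : R, 0 <= t -> 0 <= Phi t)
    (hPhi_ndecr : forall t u : R, 0 <= t -> t <= u -> Phi t <= Phi u)
    (hPhi_o : Phi =o_ (pinfty_nbhs R) (fun t : R => t * ln t ^+ d.-1)) :
  exists f : X -> R,
    in_LPhi mu Phi f /\
    {ae mu, forall x, ~ cvg (ergodic_avg U f s x @[s --> min_to_oo (n := n)])}.
Proof.
have [I [cI _ Unp]] := hnonper.
rewrite -cI in hd hPhi_o.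
(* Geometric tolerances make the total cost at most 1. *)
have delta0 k : 0 < 1 / (2 ^ k.+1)%:R :> R by rewrite divr_gt0 ?ltr0n ?expn_gt0.
have /choice[E /choice[M /choice[W EMW]]] := fun k =>
  exists_peak_set hsep hcomm Unp hd hPhi_ge0 hPhi_o (ltn0Sn k) (delta0 k).
have mE k : measurable (E k) by have [[]] := EMW k.
have mW k : measurable (W k) by have [[]] := EMW k.
have M0 k : 0 <= M k by have [] := EMW k.
have [|f [N [f0 fLPhi N0 fM]]] :=
    exists_peak_function (mu := mu) hPhi_ge0 hPhi_ndecr mE M0.
  apply: le_lt_trans (ltry 1); apply: le_trans (epsilon_trick0 xpredT ler01).
  apply: lee_nneseries => [k _ _|k _]; last by have [] := EMW k.
  by rewrite mule_ge0 ?measure_ge0// lee_fin addr_ge0 ?hPhi_ge0.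
exists f; split => //.
(* The bound [M k <= f] on [E k] holds only off [N], so the whole countable forward orbit of x must
   avoid [N]. *)
have orbN : mu.-negligible (\bigcup_(s : {ffun 'I_n -> nat})
    monomial U [set: 'I_n]%SET (fun i => Posz (s i)) @^-1` N).
  apply: negligible_countable_union => s.
  have [V <-] := monomial_mp U [set: 'I_n]%SET (fun i => Posz (s i)).
  exact: mp_preimage_negligible.
(* Almost every x is outside [W k] for infinitely many k, which is enough for unbounded averages. *)
have liminfW : mu.-negligible (\bigcup_m \bigcap_(k >= m) W k).
  apply: negligible_bigcup => m.
  have mcap : measurable (\bigcap_(k >= m) W k).
    by apply: bigcap_measurable => //; exists m => /=.
  apply: (negligible_of_le_half_pow (n := m)) => // k mk.
  have [_ _ _ muW _] := EMW k; apply: le_trans muW.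
  by apply: le_measure; rewrite ?inE//; exact: bigcap_inf.
apply: negligibleS (negligibleU orbN liminfW) => x /= /contrapT cvgx.
apply: contrapT => /not_orP[xN xW].
have /cvg_ex[l fl] := cvgx.
have ll1 : l < l + 1 by rewrite ltrDl.
have [m _ ml] := cvgr_lt _ fl _ ll1.
(* For k beyond [m] the box of stage k lies where averages stay below [l + 1]; beyond the
   truncation, its average is at least [k.+1 > l + 1]. *)
pose k0 := maxn m (Num.truncn (l + 1)).
have [k k0k Wk] : exists2 k, (k0 <= k)%N & ~ W k x.
  apply: contrapT => none; apply: xW; exists k0 => // k /= k0k.
  by apply: contrapT => Wk; apply: none; exists k.
have [_ _ _ _ /(_ x Wk) [s [ks sM Esx]]] := EMW k.
have s0 i : (0 < s i)%N by exact: leq_trans (ks i).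
have : ergodic_avg U f s x < l + 1.
  apply: ml => i /=; apply: leq_trans (ks i).
  by rewrite (leq_trans _ (leqnSn k))// (leq_trans _ k0k)// leq_maxl.
apply/negP; rewrite -leNgt; apply: le_trans _ (ergodic_avg_ge U x f0 s0).
apply: (@le_trans _ _ k.+1%:R).
  apply/ltW/(lt_le_trans (real_truncnS_gt (num_real _))).
  by rewrite ler_nat ltnS (leq_trans _ k0k)// leq_maxr.
rewrite ler_pdivlMr; last by apply: prodr_gt0 => i _; rewrite ltr0n.
apply: le_trans sM _; apply: fM => // Nsx; apply: xN.
exists [ffun i => (s i).-1] => //=.
by rewrite (_ : (fun i => _) = (fun i => Posz (s i).-1))//;
  apply/funext => i; rewrite ffunE.
Qed.
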